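(* Let $\Omega\in\mathrm{RTSeq}_n$. The torus-orbit closures contained in $X(\Omega)$ (for the diagonal torus acting on $\mathrm{Fl}_n$) are exactly the varieties $X(\Omega')$, where $\Omega'$ is obtained from $\Omega$ by choosing a subset of the letters of $\Omega$ of the form $T_i$ and replacing each chosen letter $T_i$ independently by either $R_i$ or $R_{i+1}$.
   Context: $\mathrm{Fl}_n=GL_n(\mathbb C)/B$, $X^w=\overline{BwB/B}$, $X_w=\overline{B^-wB/B}$ ($B$, $B^-$ upper/lower triangular), Richardson $X^v_u=X^v\cap X_u$. For $w\in S_m$, $1\le i\le m+1$, $\epsilon_i(w)\in S_{m+1}$: $\epsilon_i(w)(j)=w(j)+1$ ($j<i$), $1$ ($j=i$), $w(j-1)+1$ ($j>i$). $\mathrm{RTSeq}_n$ is the set of words $X_1\cdots X_n$ in formal letters with $X_i\in\{R_1,T_1,\dots,R_{i-1},T_{i-1},R_i\}$; $u(\emptyset)=v(\emptyset)=\mathrm{id}$, $(u,v)(\Omega'R_j)=(\epsilon_ju(\Omega'),\epsilon_jv(\Omega'))$, $(u,v)(\Omega'T_j)=(\epsilon_ju(\Omega'),\epsilon_{j+1}v(\Omega'))$; $X(\Omega)=X^{v(\Omega)}_{u(\Omega)}$. *)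

(* Defs.v *)
From HB Require Import structures.
From mathcomp Require Import all_boot all_order all_algebra.
From mathcomp Require Import complex.
From mathcomp Require Import Rstruct.
Set Implicit Arguments. Unset Strict Implicit. Unset Printing Implicit Defensive.
Import Order.TTheory GRing.Theory Num.Theory.
Local Open Scope ring_scope.

Definition C : numClosedFieldType := (Rdefinitions.R)[i].

Definition invertible n (g : 'M[C]_n) : Prop := g \in unitmx.

Definition in_B n (b : 'M[C]_n) : Prop :=
  invertible b /\ forall i j : 'I_n, (j < i)%N -> b i j = 0.
Definition in_Bminus n (b : 'M[C]_n) : Prop :=
  invertible b /\ forall i j : 'I_n, (i < j)%N -> b i j = 0.
Definition in_torus n (t : 'M[C]_n) : Prop :=
  invertible t /\ forall i j : 'I_n, i != j -> t i j = 0.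

(* ---------- Topology: Fl_n = GL_n(C)/B is modelled by right-B-invariant
   subsets of GL_n(C); since GL_n -> GL_n/B is open, the preimage of the
   closure of a set is the closure (in GL_n(C), Euclidean topology) of the
   preimage.  Closures of these constructible sets agree with Zariski ones. *)
Definition mx_cvg n (M : nat -> 'M[C]_n) (g : 'M[C]_n) : Prop :=
  forall e : C, 0 < e -> exists N : nat, forall k, (N <= k)%N ->
    forall i j, `|M k i j - g i j| < e.

Definition closure_GL n (S : 'M[C]_n -> Prop) : 'M[C]_n -> Prop :=
  fun g => invertible g /\ exists M : nat -> 'M[C]_n, (forall k, S (M k)) /\ mx_cvg M g.

(* ---------- permutations, given as 1-based functions nat -> nat ---------- *)
(* the permutation matrix of w : its column j is e_{w(j)}, so that
   perm_matrix w * B/B is the T-fixed point wB/B of Fl_n *)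
Definition perm_matrix n (w : nat -> nat) : 'M[C]_n :=
  \matrix_(a < n, b < n) ((a.+1 == w b.+1)%:R : C).

Definition eps (i : nat) (w : nat -> nat) : nat -> nat :=
  fun j => if (j < i)%N then (w j).+1 else if j == i then 1%N else (w j.-1).+1.

Arguments perm_matrix : clear implicits.
Definition schubert n (w : nat -> nat) : 'M[C]_n -> Prop :=
  closure_GL (fun g => exists b1 b2, in_B b1 /\ in_B b2 /\ g = b1 *m perm_matrix n w *m b2).
Definition opp_schubert n (w : nat -> nat) : 'M[C]_n -> Prop :=
  closure_GL (fun g => exists b1 b2, in_Bminus b1 /\ in_B b2 /\ g = b1 *m perm_matrix n w *m b2).
Arguments schubert : clear implicits.
Arguments opp_schubert : clear implicits.
Definition richardson n (u v : nat -> nat) : 'M[C]_n -> Prop :=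
  fun g => schubert n v g /\ opp_schubert n u g.

Arguments richardson : clear implicits.

Inductive letter := LR of nat | LT of nat.

Definition letter_ok (i : nat) (x : letter) : bool :=
  match x with
  | LR j => (1 <= j <= i)%N
  | LT j => (1 <= j)%N && (j < i)%N
  end.

Definition RTSeq (n : nat) (Om : seq letter) : Prop :=
  size Om = n /\ forall k, (k < n)%N -> letter_ok k.+1 (nth (LR 0) Om k).

Definition uv_step (p : (nat -> nat) * (nat -> nat)) (x : letter) :=
  match x with
  | LR j => (eps j p.1, eps j p.2)
  | LT j => (eps j p.1, eps j.+1 p.2)
  end.

Definition uv (Om : seq letter) : (nat -> nat) * (nat -> nat) :=
  foldl uv_step (id, id) Om.

Definition X_of (n : nat) (Om : seq letter) : 'M[C]_n -> Prop :=
  richardson n (uv Om).1 (uv Om).2.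

Arguments X_of : clear implicits.

Definition replace_T (Om Om' : seq letter) : Prop :=
  size Om' = size Om /\
  forall k, (k < size Om)%N ->
    nth (LR 0) Om' k = nth (LR 0) Om k \/
    exists i, nth (LR 0) Om k = LT i /\
      (nth (LR 0) Om' k = LR i \/ nth (LR 0) Om' k = LR i.+1).

Definition torus_orbit_closure n (Y : 'M[C]_n -> Prop) : Prop :=
  exists x : 'M[C]_n, invertible x /\
    forall g, Y g <-> closure_GL (fun h => exists t b, in_torus t /\ in_B b /\ h = t *m x *m b) g.

(* Main.v *)
Require Import Defs.
From mathcomp Require Import all_boot all_order all_algebra perm zify.
From mathcomp Require Import complex Rstruct.
From mathcomp Require Import boolp classical_sets filter topology normedtype sequences.
Set Implicit Arguments. Unset Strict Implicit. Unset Printing Implicit Defensive.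
Import Order.TTheory GRing.Theory Num.Theory.
Import numFieldNormedType.Exports.
Local Open Scope classical_set_scope.
Local Open Scope ring_scope.

(** Write [ins_j z] for the matrix obtained from [z] by inserting a first row and
    a [j]-th column meeting in an entry 1, with zeros elsewhere.  Inserting the
    value 1 at position [j] in a permutation is [ins_j] on permutation matrices.
    On [X(Om R_j)] the flag satisfies [F_(j-1) <= H] and [e_1 \in F_j], where [H]
    is the hyperplane of vectors with zero first coordinate; on [X(Om T_j)] it
    satisfies [F_(j-1) <= H] and [e_1 \in F_(j+1)].  Hence
      [X(Om R_j) = { ins_j z * b | z \in X(Om), b \in B }],
      [X(Om T_j) = { ins_j z * p | z \in X(Om), p \in P_j }],
    with [P_j] the minimal parabolic subgroup.  The same holds for torus orbit
    closures: that of [ins_j x] is built by the first rule from that of [x], and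
    that of [ins_j x * (1 + E_(j+1,j))] by the second.  A point [ins_j x * p] of
    [X(Om T_j)] with [p \in P_j] has the orbit closure of [ins_j x], of
    [ins_(j+1) x] or of [ins_j x * (1 + E_(j+1,j))], according to the first column
    of the [GL_2] block of [p]; this is the choice [R_j], [R_(j+1)] or [T_j].
    Schubert varieties, opposite Schubert varieties and torus orbit closures are
    all closures of [G x B] for [G] = [B], [B^-], [T], each of them the group of
    invertible matrices whose support lies in a fixed preorder. *)

(** * Convergence and closures *)

Lemma mx_cvgP n (M : nat -> 'M[C]_n) g :
  mx_cvg M g <-> forall i j, (fun k => M k i j) @ \oo --> g i j.
Proof.
split=> H.
  move=> i j; apply/cvgrPdist_lt => e /H[N HN].
  by exists N => // k /= Nk; rewrite distrC; exact: HN.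
move=> e e0.
have : \forall k \near \oo, forall i j, `|M k i j - g i j| < e.
  apply: filter_forall => i; apply: filter_forall => j.
  move/cvgrPdist_lt: (H i j) => /(_ e e0).
  by apply: filterS => k; rewrite distrC.
by case=> N _ HN; exists N => k; apply: HN.
Qed.

Lemma mx_cvg_cst n (g : 'M[C]_n) : mx_cvg (fun=> g) g.
Proof. by apply/mx_cvgP => i j; exact: cvg_cst. Qed.

Lemma cvg_sum_fct (I : Type) (r : seq I) (P : pred I) (f : I -> nat -> C) (l : I -> C) :
  (forall i, P i -> f i @ \oo --> l i) ->
  (fun k => \sum_(i <- r | P i) f i k) @ \oo --> \sum_(i <- r | P i) l i.
Proof. by apply: cvg_big; exact: add_continuous. Qed.

Lemma cvg_prod_fct (I : Type) (r : seq I) (P : pred I) (f : I -> nat -> C) (l : I -> C) :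
  (forall i, P i -> f i @ \oo --> l i) ->
  (fun k => \prod_(i <- r | P i) f i k) @ \oo --> \prod_(i <- r | P i) l i.
Proof. by apply: cvg_big; exact: mul_continuous. Qed.

Lemma cvg_det n (M : nat -> 'M[C]_n) g :
  mx_cvg M g -> (fun k => \det (M k)) @ \oo --> \det g.
Proof.
move=> /mx_cvgP Mg; apply: cvg_sum_fct => s _.
by apply: cvgM; [exact: cvg_cst|apply: cvg_prod_fct => i _; exact: Mg].
Qed.

Lemma mx_cvgM n (M N : nat -> 'M[C]_n) g h :
  mx_cvg M g -> mx_cvg N h -> mx_cvg (fun k => M k *m N k) (g *m h).
Proof.
move=> /mx_cvgP Mg /mx_cvgP Nh; apply/mx_cvgP => i j; rewrite mxE.
under [X in X @ _]funext do rewrite mxE.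
by apply: cvg_sum_fct => l _; apply: cvgM; [exact: Mg|exact: Nh].
Qed.

Lemma near_unitmx n (M : nat -> 'M[C]_n) g :
  mx_cvg M g -> g \in unitmx -> \forall k \near \oo, M k \in unitmx.
Proof.
move=> /cvg_det Mg; rewrite unitmxE unitfE => g0.
move/cvgrPdist_lt: Mg => /(_ `|\det g|); rewrite normr_gt0 => /(_ g0).
apply: filterS => k Hk; rewrite unitmxE unitfE.
by apply: contraTneq Hk => ->; rewrite subr0 ltxx.
Qed.

Lemma mx_cvgV n (M : nat -> 'M[C]_n) g :
  mx_cvg M g -> g \in unitmx -> mx_cvg (fun k => invmx (M k)) (invmx g).
Proof.
move=> Mg gu; apply/mx_cvgP => i j.
have Hnear := near_unitmx Mg gu.
have : (fun k => (\det (M k))^-1 * (\adj (M k)) i j) @ \oo --> invmx g i j.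
  rewrite /invmx gu mxE; apply: cvgM.
    by apply: cvgV; [rewrite -unitfE -unitmxE|exact: cvg_det].
  rewrite mxE; under [X in X @ _]funext do rewrite mxE.
  apply: cvgM; first exact: cvg_cst.
  apply: cvg_det; apply/mx_cvgP => a b; rewrite !mxE.
  under [X in X @ _]funext do rewrite !mxE.
  by move/mx_cvgP: Mg; apply.
(* [invmx] returns its argument on singular matrices, so the adjugate formula holds only from some
   index on. *)
move=> H; apply: cvg_trans H; apply: near_eq_cvg.
by near=> k; rewrite /invmx ifT ?mxE //; near: k.
Unshelve. all: by end_near. Qed.

(** Invertibility is open, so dropping finitely many terms makes the whole sequence invertible.
    Deletions need this, since a minor of an invertible matrix may be singular. *)
Lemma closure_GL_unit n (S : 'M[C]_n -> Prop) M g :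
  g \in unitmx -> mx_cvg M g -> (forall k, M k \in unitmx -> S (M k)) -> closure_GL S g.
Proof.
move=> gu Mg MS; split=> //.
have [N _ HN] := near_unitmx Mg gu.
exists (fun k => M (N + k)%N); split=> [k|].
  by apply/MS/HN => /=; exact: leq_addr.
move=> e /Mg[K HK]; exists K => k Kk; apply: HK.
exact: leq_trans (leq_addl _ _).
Qed.

Lemma closure_GL_sub n (S : 'M[C]_n -> Prop) g : g \in unitmx -> S g -> closure_GL S g.
Proof. by move=> gu Sg; split=> //; exists (fun=> g); split=> //; exact: mx_cvg_cst. Qed.

Lemma closure_GL_mono n (S S' : 'M[C]_n -> Prop) g :
  (forall h, S h -> S' h) -> closure_GL S g -> closure_GL S' g.
Proof. by move=> SS' [gu [M [MS Mg]]]; split=> //; exists M; split=> // k; apply: SS'. Qed.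

Definition harm (k : nat) : C := k.+1%:R^-1.

Lemma harm_neq0 k : harm k != 0.
Proof. by rewrite invr_eq0 pnatr_eq0. Qed.

Lemma cvg_harm : harm @ \oo --> (0 : C).
Proof.
apply/cvgrPdist_lt => e e0.
(* In the order of [C], [0 < e] forces [e] to be real, which reduces the claim to the real harmonic
   sequence. *)
have [r r0 ->] : exists2 r : Rdefinitions.R, 0 < r & e = (r%:C)%C.
  case: e e0 => a b; rewrite ltcE /= => /andP[/eqP -> a0]. by exists a.
have /cvgrPdist_lt/(_ r r0)[N _ HN] := @cvg_harmonic Rdefinitions.R.
exists N => // k /= /HN; rewrite /= !sub0r !normrN /harm /harmonic.
rewrite ger0_norm ?invr_ge0 ?ler0n //; move=> H.
rewrite ger0_norm ?invr_ge0 ?ler0n //.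
have -> : (k.+1%:R^-1 : C) = ((k.+1%:R^-1)%:C)%C by rewrite fmorphV rmorph_nat.
by rewrite ltcR.
Qed.

(** Diagonal argument: the [k]-th term is replaced by an element of [S] within [harm k] of it. *)
Lemma closure_GL_idem n (S : 'M[C]_n -> Prop) g :
  closure_GL (closure_GL S) g -> closure_GL S g.
Proof.
move=> [gu [M [MS Mg]]]; split=> //.
have harm_gt0 k : 0 < harm k by rewrite invr_gt0 ltr0n.
have /choice[N HN] : forall k, exists h, S h /\ forall i j, `|h i j - M k i j| < harm k.
  move=> k; have [_ [N [NS Nk]]] := MS k.
  by have [K HK] := Nk _ (harm_gt0 k); exists (N K); split=> // i j; exact: HK.
exists N; split=> [k|]; first by have [] := HN k.
apply/mx_cvgP => i j.
have -> : (fun k => N k i j) = (fun k => (N k i j - M k i j) + M k i j).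
  by apply/funext => k; rewrite subrK.
rewrite -[g i j]add0r; apply: cvgD; last by move/mx_cvgP: Mg; apply.
apply/cvgrPdist_lt => e e0; move/cvgrPdist_lt: cvg_harm => /(_ e e0).
apply: filterS => k; rewrite !sub0r !normrN; apply: lt_trans.
by rewrite (ger0_norm (ltW (harm_gt0 k))); have [_] := HN k; apply.
Qed.

Lemma closure_GL_mul n (S S' : 'M[C]_n -> Prop) a b g :
  a \in unitmx -> b \in unitmx -> (forall h, S h -> S' (a *m h *m b)) ->
  closure_GL S g -> closure_GL S' (a *m g *m b).
Proof.
move=> au bu SS' [gu [M [MS Mg]]]; split; first by rewrite /invertible !unitmx_mul au bu gu.
exists (fun k => a *m M k *m b); split=> [k|]; first exact: SS'.
by apply: mx_cvgM (mx_cvg_cst _); apply: mx_cvgM => //; exact: mx_cvg_cst.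
Qed.

(** * Insertion of a row and a column, and the minimal parabolic *)

Section Grp.
Variable F : fieldType.
Implicit Types r : rel nat.

(** Since [r] lives on [nat], one preorder serves every size; the condition [r k.+1 l.+1 = r k l]
    later links size [n] with size [n.+1]. *)
Definition shape r n (A : 'M[F]_n) : Prop := forall i j : 'I_n, ~~ r i j -> A i j = 0.

Definition grp r n (A : 'M[F]_n) : Prop := A \in unitmx /\ shape r A.

Lemma shapeM r n (A B : 'M[F]_n) : transitive r -> shape r A -> shape r B -> shape r (A *m B).
Proof.
move=> rT rA rB i j rij; rewrite mxE big1 // => k _.
have [rik|nrik] := boolP (r i k); last by rewrite rA ?mul0r.
by rewrite (rB k) ?mulr0 //; apply: contra rij; exact: rT.
Qed.

Lemma shape_scalar r n (a : F) : reflexive r -> shape r (a%:M : 'M_n).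
Proof. by move=> rR i j; rewrite mxE; case: eqP => // ->; rewrite rR. Qed.

Lemma shapeD r n (A B : 'M[F]_n) : shape r A -> shape r B -> shape r (A + B).
Proof. by move=> rA rB i j rij; rewrite mxE rA ?rB ?addr0. Qed.

Lemma shapeZ r n a (A : 'M[F]_n) : shape r A -> shape r (a *: A).
Proof. by move=> rA i j rij; rewrite mxE rA ?mulr0. Qed.

(* By Cayley-Hamilton the inverse of [A] is a polynomial in [A]. *)
Lemma shapeV r n (A : 'M[F]_n) :
  reflexive r -> transitive r -> A \in unitmx -> shape r A -> shape r (invmx A).
Proof.
move=> rR rT; case: n A => [|n] A Au rA; first by move=> [].
have rh p : shape r (horner_mx A p).
  elim/poly_ind: p => [|p c IH]; first by
    rewrite rmorph0 -(scale0r (1%:M)); apply/shapeZ/shape_scalar.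
  rewrite rmorphD rmorphM /= horner_mx_C horner_mx_X.
  by apply: shapeD; [exact: shapeM|exact: shape_scalar].
have := Cayley_Hamilton A; have := char_poly_det A.
elim/poly_ind: (char_poly A) => [|p c _].
  rewrite coef0 => /esym/eqP; rewrite mulf_eq0 signr_eq0 /= => /eqP dA.
  by move: Au; rewrite unitmxE dA unitr0.
rewrite coefD coefMX coefC /= add0r => cE.
rewrite rmorphD rmorphM /= horner_mx_C horner_mx_X => /eqP.
rewrite addr_eq0 => /eqP hp.
have c0 : c != 0 by rewrite cE mulf_neq0 ?signr_eq0 // -unitfE -unitmxE.
suff -> : invmx A = - c^-1 *: horner_mx A p by exact/shapeZ/rh.
have hA : (- c^-1 *: horner_mx A p) *m A = 1%:M.
  by rewrite -scalemxAl [_ *m A]hp scalerN scaleNr opprK scale_scalar_mx mulVf.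
by rewrite -[invmx A]mul1mx -hA mulmxK.
Qed.

Lemma grpM r n (A B : 'M[F]_n) : transitive r -> grp r A -> grp r B -> grp r (A *m B).
Proof.
move=> rT [Au rA] [Bu rB]; split; first by rewrite unitmx_mul Au Bu.
exact: shapeM.
Qed.

Lemma grpV r n (A : 'M[F]_n) : reflexive r -> transitive r -> grp r A -> grp r (invmx A).
Proof. by move=> rR rT [Au rA]; split; [rewrite unitmx_inv|exact: shapeV]. Qed.

Lemma grp1 r n : reflexive r -> grp r (1%:M : 'M[F]_n).
Proof. by move=> rR; split; [exact: unitmx1|exact: shape_scalar]. Qed.

Lemma grp_sub r r' n (A : 'M[F]_n) : subrel r r' -> grp r A -> grp r' A.
Proof. by move=> rr' [Au rA]; split=> // i j nr; apply: rA; apply: contra nr; exact: rr'. Qed.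

(** In entry [(j, j)] of [A *m invmx A], a nonzero term at [k] needs both [r j k] and [r k j], so
    antisymmetry leaves only [k = j]. *)
Lemma grp_diag r n (A : 'M[F]_n) j :
  reflexive r -> antisymmetric r -> transitive r -> grp r A -> A j j != 0.
Proof.
move=> rR rA rT gA; have [Au shA] := gA; have [_ shA'] := grpV rR rT gA.
have := congr1 (fun M : 'M_n => M j j) (mulmxV Au).
rewrite !mxE eqxx (bigD1 j) //= big1 ?addr0 => [|k kj].
  by move=> H; apply/eqP => A0; move/eqP: H; rewrite A0 mul0r eq_sym oner_eq0.
have [rjk|/shA->] := boolP (r j k); last by rewrite mul0r.
rewrite shA' ?mulr0 //; apply: contra kj => rkj.
by apply/eqP/val_inj/rA; rewrite rjk rkj.
Qed.

Lemma shape_leq_unit n (A : 'M[F]_n) :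
  shape leq A -> (forall i, A i i != 0) -> grp leq A.
Proof.
move=> sA A0; split=> //; rewrite -unitmx_tr unitmxE unitfE det_trig.
  by apply/prodf_neq0 => i _; rewrite mxE.
by apply/is_trig_mxP => i j ij; rewrite mxE sA // -ltnNge.
Qed.

(** Row, column and corner are all free because inverses have the form [ins j ord0], and the group
    elements acting on the two sides have the forms [ins ord0 ord0 a] and [ins j j a]. *)
Definition ins n (i j : 'I_n.+1) (a : F) (A : 'M[F]_n) : 'M[F]_n.+1 :=
  \matrix_(k, l)
    match unlift i k, unlift j l with
    | Some k', Some l' => A k' l'
    | None, None => a
    | _, _ => 0
    end.

Definition del n (i j : 'I_n.+1) (A : 'M[F]_n.+1) : 'M[F]_n :=
  \matrix_(k, l) A (lift i k) (lift j l).

Lemma invmx_mul n (A B : 'M[F]_n) :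
  A \in unitmx -> B \in unitmx -> invmx (A *m B) = invmx B *m invmx A.
Proof.
move=> Au Bu; have ABu : A *m B \in unitmx by rewrite unitmx_mul Au Bu.
by rewrite -[RHS](mulmxK ABu) -mulmxA mulmxA -(mulmxA (invmx B)) mulKmx // mulVmx // mul1mx.
Qed.

Section Ins.
Variable n : nat.
Implicit Types (i j : 'I_n.+1) (A B : 'M[F]_n) (M N : 'M[F]_n.+1).

Lemma insE i j a A :
  (ins i j a A i j = a) *
  ((forall l, ins i j a A i (lift j l) = 0) *
  ((forall k, ins i j a A (lift i k) j = 0) *
   (forall k l, ins i j a A (lift i k) (lift j l) = A k l))).
Proof. by do !split=> *; rewrite mxE ?unlift_none ?liftK. Qed.

Lemma ins_eq i j a A M :
  M i j = a -> (forall l, M i (lift j l) = 0) -> (forall k, M (lift i k) j = 0) ->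
  (forall k l, M (lift i k) (lift j l) = A k l) -> M = ins i j a A.
Proof.
move=> ea er ec eA; apply/matrixP => k l.
by case: (unliftP i k) => [k'|] ->; case: (unliftP j l) => [l'|] ->; rewrite insE.
Qed.

Lemma ins_mul i j (k : 'I_n.+1) a b A B : ins i j a A *m ins j k b B = ins i k (a * b) (A *m B).
Proof.
apply: ins_eq => *; rewrite mxE (bigD1_ord j) //= !insE.
- by rewrite big1 ?addr0 // => *; rewrite !insE mul0r.
- by rewrite mulr0 add0r big1 // => *; rewrite !insE mul0r.
- by rewrite mul0r add0r big1 // => *; rewrite !insE mulr0.
by rewrite mul0r add0r mxE; apply: eq_bigr => *; rewrite !insE.
Qed.

Lemma ins1 i : ins i i 1 1%:M = 1%:M.
Proof.
apply/esym/ins_eq => *; rewrite !mxE ?eqxx //.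
- by rewrite (negPf (neq_lift _ _)).
- by rewrite eq_sym (negPf (neq_lift _ _)).
by rewrite (inj_eq lift_inj).
Qed.

Lemma ins_unit i j a A : a != 0 -> A \in unitmx -> ins i j a A \in unitmx.
Proof.
move=> a0 Au; have /mulmx1_unit[] // : ins i j a A *m ins j i a^-1 (invmx A) = 1%:M.
by rewrite ins_mul mulfV // mulmxV // ins1.
Qed.

Lemma ins_inv i j A : A \in unitmx -> invmx (ins i j 1 A) = ins j i 1 (invmx A).
Proof.
move=> Au; have Iu := ins_unit i j (oner_neq0 F) Au.
by rewrite -[RHS](mulKmx Iu) ins_mul mulr1 mulmxV // ins1 mulmx1.
Qed.

Lemma ins_unitE i j A : (ins i j 1 A \in unitmx) -> A \in unitmx.
Proof.
move=> Iu; set D := del j i (invmx (ins i j 1 A)).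
have /mulmx1_unit[] // : A *m D = 1%:M.
apply/matrixP => k l.
have := congr1 (fun M : 'M_n.+1 => M (lift i k) (lift i l)) (mulmxV Iu).
rewrite mxE (bigD1_ord j) //= insE mul0r add0r !mxE (inj_eq lift_inj) => <-.
by apply: eq_bigr => m _; rewrite insE mxE.
Qed.

Lemma delE i j M k l : del i j M k l = M (lift i k) (lift j l).
Proof. by rewrite mxE. Qed.

Lemma del_ins i j a A : del i j (ins i j a A) = A.
Proof. by apply/matrixP => k l; rewrite mxE insE. Qed.

(** The two sides differ only by the terms through the index [k], which the hypothesis kills. *)
Lemma del_mul i (k : 'I_n.+1) j M N :
  (forall a b, M (lift i a) k * N k (lift j b) = 0) ->
  del i j (M *m N) = del i k M *m del k j N.
Proof.
move=> MN0; apply/matrixP => a b; rewrite !mxE (bigD1_ord k) //= MN0 add0r.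
by apply: eq_bigr => c _; rewrite !mxE.
Qed.

End Ins.

Lemma shape_ins00 r n a (A : 'M[F]_n) :
  reflexive r -> (forall k l, r k.+1 l.+1 = r k l) -> shape r A -> shape r (ins ord0 ord0 a A).
Proof.
move=> rR rS rA k l; case: (unliftP ord0 k) => [k'|] ->; case: (unliftP ord0 l) => [l'|] ->;
  rewrite insE ?rR //.
by rewrite !lift0 rS; exact: rA.
Qed.

Lemma grp_ins00 r n a (A : 'M[F]_n) :
  reflexive r -> (forall k l, r k.+1 l.+1 = r k l) -> a != 0 -> grp r A ->
  grp r (ins ord0 ord0 a A).
Proof. by move=> rR rS a0 [Au rA]; split; [exact: ins_unit|exact: shape_ins00]. Qed.

Lemma grp_insdiag n j a (A : 'M[F]_n) : a != 0 -> grp leq A -> grp leq (ins j j a A).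
Proof.
move=> a0 [Au sA]; split; first exact: ins_unit.
move=> k l; case: (unliftP j k) => [k'|] ->; case: (unliftP j l) => [l'|] ->;
  rewrite insE ?leqnn // => kl.
by apply: sA; rewrite leq_bump2 in kl.
Qed.

Lemma shape_del00 r n (M : 'M[F]_n.+1) :
  (forall k l, r k.+1 l.+1 = r k l) -> shape r M -> shape r (del ord0 ord0 M).
Proof. by move=> rS rM k l kl; rewrite mxE rM // !lift0 rS. Qed.

(** The preorder of P_j, with indices from 0: the one extra position is [(j.+1, j)]. *)
Definition parab (j : nat) : rel nat := fun k l => (k <= l)%N || (k == j.+1) && (l == j).

Lemma parab_refl j : reflexive (parab j).
Proof. by move=> k; rewrite /parab leqnn. Qed.

Lemma parab_trans j : transitive (parab j).
Proof.
move=> l k m; rewrite /parab.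
move=> /orP[kl|/andP[/eqP-> /eqP->]] /orP[lm|/andP[/eqP el /eqP->]].
- by rewrite (leq_trans kl lm).
- move: kl; rewrite el leq_eqVlt ltnS => /orP[/eqP->|->//].
  by rewrite !eqxx orbT.
- by move: lm; rewrite leq_eqVlt => /orP[/eqP<-|->//]; rewrite !eqxx orbT.
- by rewrite !eqxx orbT.
Qed.

Lemma leq_parab j : subrel leq (parab j).
Proof. by move=> k l kl; rewrite /parab kl. Qed.

(** The only subdiagonal position allowed, [(j.+1, j)], lies in the deleted column. *)
Lemma shape_del_parab n (j : 'I_n.+1) (M : 'M[F]_n.+1) :
  shape (parab j) M -> shape leq (del j j M).
Proof.
move=> sM k l kl; rewrite mxE sM // /parab /= leq_bump2 (negPf kl) /=.
by rewrite [_ == val j]eq_sym (negPf (neq_bump _ _)) andbF.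
Qed.

Definition elem n (i j : 'I_n) (c : F) : 'M[F]_n := 1%:M + c *: delta_mx i j.

Lemma elem0 n (i j : 'I_n) : elem i j 0 = 1%:M.
Proof. by rewrite /elem scale0r addr0. Qed.

Lemma elem_mulE n (i j : 'I_n) c (M : 'M[F]_n) k l :
  (elem i j c *m M) k l = M k l + (if k == i then c * M j l else 0).
Proof.
rewrite mulmxDl mul1mx -scalemxAl mxE [X in _ + X]mxE [X in c * X]mxE; congr (_ + _).
rewrite (bigD1 j) //= big1 => [|m mj]; last by rewrite mxE (negPf mj) andbF mul0r.
by rewrite mxE eqxx andbT addr0; case: ifP => _; rewrite ?mul1r // mul0r mulr0.
Qed.

Lemma mul_elemE n (i j : 'I_n) c (M : 'M[F]_n) k l :
  (M *m elem i j c) k l = M k l + (if l == j then M k i * c else 0).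
Proof.
rewrite mulmxDr mulmx1 -scalemxAr mxE [X in _ + X]mxE [X in c * X]mxE; congr (_ + _).
rewrite (bigD1 i) //= big1 => [|m mi]; last by rewrite mxE (negPf mi) mulr0.
by rewrite mxE eqxx addr0; case: ifP => _; [rewrite mulr1 mulrC|rewrite !mulr0].
Qed.

Lemma elemV n (i j : 'I_n) c : i != j -> elem i j c *m elem i j (- c) = 1%:M.
Proof.
move=> ij; apply/matrixP => k l; rewrite elem_mulE !mxE [j == i]eq_sym (negPf ij) /=.
rewrite mulr0 addr0 [j == l]eq_sym.
case: (k == i); last by rewrite mulr0 !addr0.
by case: (l == j); rewrite /= ?mulr1 ?mulr0 ?addr0 ?subrK.
Qed.

Lemma elem_unit n (i j : 'I_n) c : i != j -> elem i j c \in unitmx.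
Proof. by move=> ij; have [] := mulmx1_unit (elemV c ij). Qed.

Lemma elem_grp r n (i j : 'I_n) c : reflexive r -> i != j -> r i j -> grp r (elem i j c).
Proof.
move=> rR ij rij; split; first exact: elem_unit.
apply: shapeD; first exact: shape_scalar.
apply: shapeZ => k l; rewrite mxE; have [->|//] := eqVneq k i; have [->|//] := eqVneq l j.
by rewrite rij.
Qed.

(** * Factorizations in P_j and of flags in special position *)

Section Parabolic.
Variables (n : nat) (j j1 : 'I_n.+1).
Hypothesis jj1 : j1 = j.+1 :> nat.

Let j1j : j1 != j.
Proof. by rewrite -val_eqE /= jj1 gtn_eqF. Qed.

Lemma parab_elem c : grp (parab j) (elem j1 j c).
Proof. by apply: elem_grp => //; [exact: parab_refl|rewrite /parab jj1 !eqxx orbT]. Qed.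

Lemma parab_leq (p : 'M[F]_n.+1) : grp (parab j) p -> p j1 j = 0 -> grp leq p.
Proof.
move=> [pu sp] p0; split=> // k l kl.
have [/andP[/eqP kj /eqP lj]|nkl] := boolP ((k == j1) && (l == j)); first by rewrite kj lj.
by apply: sp; rewrite /parab (negPf kl) /= -jj1.
Qed.

(** The pivot [p j j] clears the entry [(j1, j)] by a row operation. This is an affine chart of the
    projective line P_j/B; [parab_tperm_factor] treats the remaining point. *)
Lemma parab_factor (p : 'M[F]_n.+1) : grp (parab j) p -> p j j != 0 ->
  exists2 b, grp leq b & p = elem j1 j (p j1 j / p j j) *m b.
Proof.
move=> pP pjj; set c := _ / _; exists (elem j1 j (- c) *m p).
  apply: parab_leq; last by rewrite elem_mulE eqxx mulNr divfK ?subrr.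
  by apply: grpM pP; [exact: parab_trans|exact: parab_elem].
by rewrite mulmxA elemV // mul1mx.
Qed.

Lemma tperm_mulE (M : 'M[F]_n.+1) k l : (tperm_mx j j1 *m M) k l = M (tperm j j1 k) l.
Proof. by rewrite -xrowE mxE. Qed.

Lemma mul_tpermE (M : 'M[F]_n.+1) k l : (M *m tperm_mx j j1) k l = M k (tperm j j1 l).
Proof. by rewrite -xcolE mxE. Qed.

Lemma parab_tperm : grp (parab j) (tperm_mx j j1 : 'M[F]_n.+1).
Proof.
split; first exact: unitmx_perm.
move=> k l; rewrite -[tperm_mx _ _]mulmx1 tperm_mulE mxE => /norP[kl njl].
case: eqP => // E; move: kl njl; rewrite -E; case: tpermP => [->|->|_ _].
- by rewrite jj1 leqnSn.
- by rewrite jj1 !eqxx.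
by rewrite leqnn.
Qed.

Lemma parab_tperm_factor (p : 'M[F]_n.+1) :
  grp (parab j) p -> p j j = 0 -> grp leq (tperm_mx j j1 *m p).
Proof.
move=> pP p0; apply: parab_leq; last by rewrite tperm_mulE tpermR.
by apply: grpM pP; [exact: parab_trans|exact: parab_tperm].
Qed.

Lemma tperm_mxK : tperm_mx j j1 *m tperm_mx j j1 = 1%:M :> 'M[F]_n.+1.
Proof. by rewrite -perm_mxM tperm2 perm_mx1. Qed.

Lemma lift_tperm (l : 'I_n) : tperm j j1 (lift j1 l) = lift j l.
Proof.
apply: val_inj; case: tpermP => [/(congr1 val)|/(congr1 val)|/eqP + /eqP];
  rewrite -?val_eqE /= /bump jj1; lia.
Qed.

(** Passing from R_j to R_(j+1) is right multiplication by the simple transposition in P_j. *)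
Lemma ins_tperm (i : 'I_n.+1) a (A : 'M[F]_n) : ins i j a A *m tperm_mx j j1 = ins i j1 a A.
Proof. by apply: ins_eq => *; rewrite mul_tpermE ?tpermR ?lift_tperm insE. Qed.

(** The hypotheses say that the first [j] columns of [g] lie in H and that e_1 lies in the span of
    the first [j.+1]. Column operations from B then create the column e_1 at position [j] and clear
    the rest of the first row. *)
Lemma ins_leq_factor (g : 'M[F]_n.+1) : g \in unitmx ->
  (forall b : 'I_n.+1, (b < j)%N -> g ord0 b = 0) ->
  (forall a : 'I_n.+1, (j < a)%N -> invmx g a ord0 = 0) ->
  exists z b, [/\ z \in unitmx, grp leq b & g = ins ord0 j 1 z *m b].
Proof.
move=> gu g0 c0; pose c := invmx g.
have gc k : \sum_l g k l * c l ord0 = (k == ord0)%:R.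
  by have := congr1 (fun M : 'M_n.+1 => M k ord0) (mulmxV gu); rewrite !mxE.
(* Terms left of [j] vanish by [g0], those right of [j] by [c0]. Hence the diagonal entry of [b1] at
   [j] will be nonzero. *)
have cj : g ord0 j * c j ord0 = 1.
  have := gc ord0; rewrite (bigD1 j) //= big1 ?addr0 => [->|l] //.
  by rewrite neq_ltn => /orP[/g0->|/c0 Hc]; rewrite ?mul0r // /c Hc mulr0.
(* As [g *m c] is the identity, [b1] turns column [j] of [g] into e_1. *)
pose b1 : 'M[F]_n.+1 := \matrix_(k, l) if l == j then c k ord0 else (k == l)%:R.
(* Row [j] of [b2] records the first row of [g *m b1], so dividing by [b2] on the right clears that
   row. *)
pose b2 : 'M[F]_n.+1 :=
  \matrix_(k, l) if k == j then (if l == j then 1 else g ord0 l) else (k == l)%:R.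
have b1B : grp leq b1.
  apply: shape_leq_unit => [k l|k].
    rewrite mxE -ltnNge => lk; case: eqP => [lj|_]; first by rewrite /c c0 // -lj.
    by rewrite -val_eqE /= gtn_eqF.
  rewrite mxE; case: (k =P j) => [->|_]; last by rewrite eqxx oner_neq0.
  by apply/eqP => cj0; move/eqP: cj; rewrite cj0 mulr0 eq_sym oner_eq0.
have b2B : grp leq b2.
  apply: shape_leq_unit => [k l|k].
    rewrite mxE -ltnNge => lk; case: (k =P j) => [kj|_].
      by rewrite -kj -val_eqE /= (ltn_eqF lk) g0 // -kj.
    by rewrite -val_eqE /= gtn_eqF.
  by rewrite mxE; case: (k =P j) => _; rewrite ?eqxx oner_neq0.
have hE k l : (g *m b1) k l = if l == j then (k == ord0)%:R else g k l.
  rewrite mxE -gc; under eq_bigr do rewrite mxE.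
  case: eqP => // _; rewrite (bigD1 l) //= eqxx mulr1 big1 ?addr0 // => m ml.
  by rewrite (negPf ml) mulr0.
pose z := del ord0 j (g *m b1).
have hb2 : g *m b1 = ins ord0 j 1 z *m b2.
  have b2j l : b2 j l = if l == j then 1 else g ord0 l by rewrite mxE eqxx.
  apply/matrixP => k l; rewrite hE [RHS]mxE (bigD1_ord j) //= b2j.
  have b2l m : b2 (lift j m) l = (lift j m == l)%:R.
    by rewrite mxE eq_sym (negPf (neq_lift _ _)).
  under eq_bigr do rewrite b2l.
  case: (unliftP j l) => [l' ->|->].
    rewrite eq_sym (negPf (neq_lift _ _)) (bigD1 l') //= eqxx mulr1 big1 => [|m ml]; last first.
      by rewrite (inj_eq lift_inj) (negPf ml) mulr0.
    rewrite addr0; case: (unliftP ord0 k) => [k' ->|->]; rewrite insE.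
      by rewrite mul0r add0r insE /z delE hE eq_sym (negPf (neq_lift _ _)).
    by rewrite mul1r insE addr0.
  rewrite eqxx mulr1 big1 => [|m _]; last by rewrite eq_sym (negPf (neq_lift _ _)) mulr0.
  by rewrite addr0; case: (unliftP ord0 k) => [k' ->|->]; rewrite insE.
have [b1u _] := b1B; have [b2u _] := b2B.
exists z, (b2 *m invmx b1); split.
- apply: (@ins_unitE _ ord0 j); have : g *m b1 \in unitmx by rewrite unitmx_mul gu b1u.
  by rewrite hb2 unitmx_mul => /andP[].
- exact: grpM leq_trans b2B (grpV leqnn leq_trans b1B).
by rewrite mulmxA -hb2 mulmxK.
Qed.
End Parabolic.

(** The hypotheses concern only the spans of the first [j] and the first [j.+2] columns, which P_j
    preserves. Some [q] in P_j puts the first [j.+1] columns in H; then [ins_leq_factor] applies at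
    [j1], and the transposition brings the inserted column back to [j]. *)
Lemma ins_parab_factor n (j j1 : 'I_n.+1) (g : 'M[F]_n.+1) : j1 = j.+1 :> nat -> g \in unitmx ->
  (forall b : 'I_n.+1, (b < j)%N -> g ord0 b = 0) ->
  (forall a : 'I_n.+1, (j1 < a)%N -> invmx g a ord0 = 0) ->
  exists z p, [/\ z \in unitmx, grp (parab j) p & g = ins ord0 j 1 z *m p].
Proof.
move=> jj1 gu g0 c0.
(* Entry [(0, j)] is cleared by a column swap if entry [(0, j1)] is zero, and otherwise by
   subtracting a multiple of column [j1]. *)
have [q qP gq0] : exists2 q, grp (parab j) q & (g *m q) ord0 j = 0.
  have [g1|g1] := eqVneq (g ord0 j1) 0.
    by exists (tperm_mx j j1); [exact: parab_tperm|rewrite mul_tpermE tpermL].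
  exists (elem j1 j (- (g ord0 j / g ord0 j1))); first exact: parab_elem.
  by rewrite mul_elemE eqxx mulrN mulrC divfK // subrr.
have [qu sq] := qP; have [_ sqV] := grpV (@parab_refl j) (@parab_trans j) qP.
have gqu : g *m q \in unitmx by rewrite unitmx_mul gu qu.
have [b|a|z [b [zu bB gq]]] := @ins_leq_factor _ j1 _ gqu.
- rewrite jj1 ltnS leq_eqVlt => /orP[/eqP/val_inj->//|bj].
  rewrite mxE big1 // => l _; have [lj|jl] := ltnP l j; first by rewrite g0 ?mul0r.
  by rewrite sq ?mulr0 // /parab negb_or -ltnNge (leq_trans bj jl) /= (ltn_eqF bj) andbF.
- move=> j1a; rewrite invmx_mul // mxE big1 // => l _.
  have [la|al] := ltnP l a; last by rewrite c0 ?mulr0 // (leq_trans j1a).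
  by rewrite sqV ?mul0r // /parab negb_or -ltnNge la -jj1 (gtn_eqF j1a).
exists z, (tperm_mx j j1 *m b *m invmx q); split=> //.
  have sP := grpM (@parab_trans j) (parab_tperm jj1) (grp_sub (@leq_parab j) bB).
  exact: grpM (@parab_trans j) sP (grpV (@parab_refl j) (@parab_trans j) qP).
by rewrite !mulmxA ins_tperm // -gq mulmxK.
Qed.
End Grp.

(** * Closures of [G x B] *)

Lemma mx_cvg_entry0 n (M : nat -> 'M[C]_n) g i j :
  mx_cvg M g -> (forall k, M k i j = 0) -> g i j = 0.
Proof.
move=> Mg M0; apply/eqP; apply: contraT => g0.
have [N HN] := Mg `|g i j| ltac:(by rewrite normr_gt0).
by have := HN N (leqnn N) i j; rewrite M0 sub0r normrN ltxx.
Qed.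

Lemma mx_cvg_del n (i j : 'I_n.+1) (M : nat -> 'M[C]_n.+1) g :
  mx_cvg M g -> mx_cvg (fun k => del i j (M k)) (del i j g).
Proof.
by move=> Mg e /Mg[N HN]; exists N => k Nk a b; rewrite !delE; exact: HN.
Qed.

Lemma mx_cvg_ins n (i j : 'I_n.+1) c (M : nat -> 'M[C]_n) g :
  mx_cvg M g -> mx_cvg (fun k => ins i j c (M k)) (ins i j c g).
Proof.
move=> Mg e e0; have [N HN] := Mg e e0; exists N => k Nk a b.
by case: (unliftP i a) => [a'|] ->; case: (unliftP j b) => [b'|] ->;
  rewrite !insE ?subrr ?normr0 //; exact: HN.
Qed.

Lemma mx_cvg_elem n (i j : 'I_n) : mx_cvg (fun k => elem i j (harm k)) (1%:M : 'M[C]_n).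
Proof.
apply/mx_cvgP => a b; rewrite -(elem0 C i j) /elem !mxE.
under [X in X @ _]funext do rewrite !mxE.
apply: cvgD; first exact: cvg_cst.
by apply: cvgM; [exact: cvg_harm|exact: cvg_cst].
Qed.

(** The right group is a parameter because the bounds for the letter T_j use P_j in place of B. *)
Definition double_coset (r r' : rel nat) n (x : 'M[C]_n) : 'M[C]_n -> Prop :=
  fun g => exists t q, [/\ grp r t, grp r' q & g = t *m x *m q].

Definition orbit_closure (r : rel nat) n (x : 'M[C]_n) : 'M[C]_n -> Prop :=
  closure_GL (double_coset r leq x).

Section Orbits.
Variable r : rel nat.
Hypotheses (rR : reflexive r) (rT : transitive r) (rS : forall k l, r k.+1 l.+1 = r k l).

Lemma closure_double_coset_mul (r' : rel nat) n (x t g q : 'M[C]_n) :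
  transitive r' -> grp r t -> grp r' q ->
  closure_GL (double_coset r r' x) g -> closure_GL (double_coset r r' x) (t *m g *m q).
Proof.
move=> r'T tr qr'; apply: closure_GL_mul; [by case: tr|by case: qr'|].
move=> h [t' [q' [tr' qr'' ->]]]; exists (t *m t'), (q' *m q); split.
- exact: grpM tr tr'.
- exact: grpM qr'' qr'.
by rewrite !mulmxA.
Qed.

Lemma orbit_closure_mulr n (x g b : 'M[C]_n) :
  grp leq b -> orbit_closure r x g -> orbit_closure r x (g *m b).
Proof.
by move=> bB xg; rewrite -[g]mul1mx; apply: closure_double_coset_mul => //;
  [exact: leq_trans|exact: grp1].
Qed.

Lemma orbit_closure_mull n (x g t : 'M[C]_n) :
  grp r t -> orbit_closure r x g -> orbit_closure r x (t *m g).
Proof.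
by move=> tr xg; rewrite -[t *m g]mulmx1; apply: closure_double_coset_mul => //;
  [exact: leq_trans|exact: grp1 leqnn].
Qed.

Lemma orbit_closure_eqmx n (x t b : 'M[C]_n) g :
  grp r t -> grp leq b -> orbit_closure r (t *m x *m b) g <-> orbit_closure r x g.
Proof.
move=> tr bB; have [tu _] := tr; have [bu _] := bB.
split; apply: closure_GL_mono => h [t' [b' [tr' bB' ->]]].
  exists (t' *m t), (b *m b'); split; [exact: grpM tr' tr|exact: grpM leq_trans bB bB'|].
  by rewrite !mulmxA.
exists (t' *m invmx t), (invmx b *m b'); split.
- exact: grpM tr' (grpV rR rT tr).
- exact: grpM leq_trans (grpV leqnn leq_trans bB) bB'.
by rewrite !mulmxA mulmxKV // -(mulmxA (t' *m x)) mulmxV // mulmx1.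
Qed.

Lemma orbit_closure_self n (x : 'M[C]_n) : x \in unitmx -> orbit_closure r x x.
Proof.
move=> xu; apply: closure_GL_sub => //; exists 1%:M, 1%:M.
by split; [exact: grp1|exact: grp1 leqnn|rewrite mul1mx mulmx1].
Qed.

(** Insertion is multiplicative: [t *m x *m b'] goes to [ins ord0 ord0 1 t *m ins ord0 j 1 x *m ins
    j j 1 b'], with outer factors again in the two groups. *)
Lemma orbit_closure_ins n j (x z : 'M[C]_n) b :
  grp leq b -> orbit_closure r x z -> orbit_closure r (ins ord0 j 1 x) (ins ord0 j 1 z *m b).
Proof.
move=> bB [zu [M [Mx Mz]]]; apply: orbit_closure_mulr => //; split.
  by apply: ins_unit; rewrite ?oner_neq0.
exists (fun k => ins ord0 j 1 (M k)); split; last exact: mx_cvg_ins.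
move=> k; have [t [b' [tr bB' ->]]] := Mx k.
exists (ins ord0 ord0 1 t), (ins j j 1 b'); split.
- by apply: grp_ins00; rewrite ?oner_neq0.
- by apply: grp_insdiag; rewrite ?oner_neq0.
by rewrite !ins_mul !mulr1.
Qed.

(** * Conditions on a closure, and recovery of the smaller flag by deletion *)

Section Deletion.
Variables (n : nat) (j : 'I_n.+1).

(** The first column of [t] vanishes below the corner, so deletion acts factor by factor, and
    [del j j q] is upper triangular even for [q] in P_j. Deletion is continuous, so the limit
    follows. *)
Lemma closure_del_col0 (x z : 'M[C]_n) : (forall k, r k.+1 0 = false) -> z \in unitmx ->
  closure_GL (double_coset r (parab j) (ins ord0 j 1 x)) (ins ord0 j 1 z) -> orbit_closure r x z.
Proof.
move=> r0 zu [_ [M [Mx Mz]]].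
have Dz := mx_cvg_del ord0 j Mz; rewrite del_ins in Dz.
apply: closure_GL_unit zu Dz _ => k.
have [t [q [[_ st] [_ sq] ->]]] := Mx k.
have -> : del ord0 j (t *m ins ord0 j 1 x *m q) = del ord0 ord0 t *m x *m del j j q.
  rewrite -mulmxA (del_mul (k := ord0)) => [|a b].
    by rewrite (del_mul (k := j)) ?del_ins ?mulmxA // => a b; rewrite insE mul0r.
  by rewrite st ?mul0r // lift0 r0.
rewrite !unitmx_mul -andbA => /and3P[tu xu qu].
exists (del ord0 ord0 t), (del j j q); split=> //; split=> //; first exact: shape_del00.
exact: shape_del_parab.
Qed.

(** Now it is the first row of [t] that vanishes off the corner. The product need not delete factor
    by factor but its inverse does, so the argument of [closure_del_col0] runs on inverses. *)
Lemma closure_del_row0 (x z : 'M[C]_n) : (forall k, r 0 k.+1 = false) ->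
  x \in unitmx -> z \in unitmx ->
  closure_GL (double_coset r (parab j) (ins ord0 j 1 x)) (ins ord0 j 1 z) -> orbit_closure r x z.
Proof.
move=> r0 xu zu [Iu [M [Mx Mz]]].
have Dz := mx_cvg_del j ord0 (mx_cvgV Mz Iu).
rewrite ins_inv // del_ins in Dz.
have := mx_cvgV Dz; rewrite unitmx_inv invmxK => /(_ zu) {}Dz.
apply: closure_GL_unit zu Dz _ => k; rewrite unitmx_inv.
have [t [q [tr qP ->]]] := Mx k.
have [tu _] := tr; have [qu _] := qP.
have [_ st] := grpV rR rT tr; have [_ sq] := grpV (@parab_refl j) (@parab_trans j) qP.
have Ixu : ins ord0 j 1 x \in unitmx by apply: ins_unit; rewrite ?oner_neq0.
rewrite !invmx_mul ?unitmx_mul ?tu ?Ixu // ins_inv //.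
have -> : del j ord0 (invmx q *m (ins j ord0 1 (invmx x) *m invmx t)) =
          del j j (invmx q) *m invmx x *m del ord0 ord0 (invmx t).
  rewrite mulmxA (del_mul (k := ord0)) => [|a b].
    by rewrite (del_mul (k := j)) ?del_ins // => a b; rewrite insE mulr0.
  by rewrite st ?mulr0 // lift0 r0.
rewrite !unitmx_mul -andbA => /and3P[Qu _ Tu].
rewrite !invmx_mul ?unitmx_mul ?Qu ?unitmx_inv ?xu // invmxK mulmxA.
exists (invmx (del ord0 ord0 (invmx t))), (invmx (del j j (invmx q))); split=> //.
  by apply: grpV => //; split=> //; exact: shape_del00.
by apply: (grpV leqnn leq_trans); split=> //; exact: shape_del_parab.
Qed.

(** The first column of [invmx t] is a multiple of e_1, which the inverse of [ins ord0 j 1 x] sends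
    to the basis vector at [j]. So only column [j] of [invmx q] contributes, and vanishing survives
    the limit. *)
Lemma closure_inv_col0 (r' : rel nat) (x : 'M[C]_n) g (a : 'I_n.+1) :
  reflexive r' -> transitive r' -> (forall k, r k.+1 0 = false) -> x \in unitmx ->
  closure_GL (double_coset r r' (ins ord0 j 1 x)) g -> ~~ r' a j -> invmx g a ord0 = 0.
Proof.
move=> r'R r'T r0 xu [gu [M [Mx Mg]]] raj.
apply: (mx_cvg_entry0 (mx_cvgV Mg gu)) => k; have [t [q [tr qr' ->]]] := Mx k.
have [tu _] := tr; have [qu _] := qr'.
have [_ st] := grpV rR rT tr; have [_ sq] := grpV r'R r'T qr'.
have Ixu : ins ord0 j 1 x \in unitmx by apply: ins_unit; rewrite ?oner_neq0.
rewrite !invmx_mul ?unitmx_mul ?tu ?Ixu // ins_inv // mulmxA mxE (bigD1_ord ord0) //=.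
rewrite [X in _ + X]big1 ?addr0 => [|l _]; last by rewrite st ?mulr0 // lift0 r0.
rewrite mxE (bigD1_ord j) //= insE sq // mul0r add0r big1 ?mul0r // => l _.
by rewrite insE mulr0.
Qed.

Lemma closure_row0 (r' : rel nat) (x : 'M[C]_n) g (b : 'I_n.+1) :
  (forall k, r 0 k.+1 = false) ->
  closure_GL (double_coset r r' (ins ord0 j 1 x)) g -> ~~ r' j b -> g ord0 b = 0.
Proof.
move=> r0 [gu [M [Mx Mg]]] rjb.
apply: (mx_cvg_entry0 Mg) => k; have [t [q [[_ st] [_ sq] ->]]] := Mx k.
rewrite -mulmxA mxE (bigD1_ord ord0) //= [X in _ + X]big1 ?addr0 => [|l _]; last first.
  by rewrite st ?mul0r // lift0 r0.
rewrite mxE (bigD1_ord j) //= sq // mulr0 add0r big1 ?mulr0 // => l _.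
by rewrite insE mul0r.
Qed.

End Deletion.

(** * Degenerations along the projective line P_j/B *)

Section Parabolic.
Variables (n : nat) (j j1 : 'I_n.+1).
Hypothesis jj1 : j1 = j.+1 :> nat.

Let j1j : j1 != j.
Proof. by rewrite -val_eqE /= jj1 gtn_eqF. Qed.

(** Torus conjugation rescales the root subgroup, which makes all nonzero parameters equivalent. *)
Lemma scale_elem (c : C) : c != 0 ->
  ins j j c^-1 1%:M *m elem j1 j 1 *m ins j j c 1%:M = elem j1 j c.
Proof.
move=> c0; have [m j1E] : exists m, j1 = lift j m.
  by case: (unliftP j j1) j1j => [m ->|->]; [exists m|rewrite eqxx].
have -> : ins j j c^-1 1%:M *m elem j1 j 1 = elem j1 j c *m ins j j c^-1 1%:M.
  apply/matrixP => k l; rewrite mul_elemE elem_mulE; congr (_ + _).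
  rewrite j1E mulr1; case: (unliftP j k) => [k'|] ->; case: (unliftP j l) => [l'|] ->;
    rewrite !insE ?eqxx ?[lift j _ == j]eq_sym ?(negPf (neq_lift _ _)) ?(inj_eq lift_inj) //.
  - by rewrite mulr0 if_same.
  - by rewrite mxE mulfV //; case: ifP.
by rewrite -mulmxA ins_mul mulVf // mulmx1 ins1 mulmx1.
Qed.

Lemma double_coset_parab (x : 'M[C]_n) p : grp (parab j) p -> p j j != 0 -> p j1 j != 0 ->
  double_coset r leq (ins ord0 j 1 x *m elem j1 j 1) (ins ord0 j 1 x *m p).
Proof.
move=> pP pjj pj1j; have [b bB ->] := parab_factor jj1 pP pjj.
set c := _ / _; have c0 : c != 0 by rewrite mulf_neq0 ?invr_eq0.
(* The diagonal factor [ins j j c^-1 1%:M] slides left through [ins ord0 j 1 x] and becomes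
   [ins ord0 ord0 c^-1 1%:M], which is in [grp r] by reflexivity. *)
exists (ins ord0 ord0 c^-1 1%:M), (ins j j c 1%:M *m b); split.
- by apply: grp_ins00; rewrite ?invr_eq0 //; exact: grp1.
- apply: grpM leq_trans _ bB; apply: grp_insdiag => //; exact: grp1 leqnn.
rewrite -(scale_elem c0) !mulmxA !ins_mul.
by rewrite mul1r mulr1 mulmx1 mul1mx.
Qed.

Lemma closure_elem_limit (S : 'M[C]_n.+1 -> Prop) (g p : 'M[C]_n.+1) (a b : 'I_n.+1) :
  g *m p \in unitmx -> (forall k, closure_GL S (g *m (elem a b (harm k) *m p))) ->
  closure_GL S (g *m p).
Proof.
move=> gpu Sg; apply: closure_GL_idem; split=> //.
exists (fun k => g *m (elem a b (harm k) *m p)); split=> //.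
apply: mx_cvgM; first exact: mx_cvg_cst.
rewrite -[X in mx_cvg _ X]mul1mx.
by apply: mx_cvgM; [exact: mx_cvg_elem|exact: mx_cvg_cst].
Qed.

(** When [p j j] and [p j1 j] are both nonzero, [double_coset_parab] applies; every other [p] is a
    limit of such matrices. *)
Lemma orbit_closure_ins_parab_self (x : 'M[C]_n) p : x \in unitmx -> grp (parab j) p ->
  orbit_closure r (ins ord0 j 1 x *m elem j1 j 1) (ins ord0 j 1 x *m p).
Proof.
move=> xu.
have Iu : ins ord0 j 1 x \in unitmx by apply: ins_unit; rewrite ?oner_neq0.
have H q : grp (parab j) q -> q j j != 0 ->
    orbit_closure r (ins ord0 j 1 x *m elem j1 j 1) (ins ord0 j 1 x *m q).
  move=> qP qjj; have [qu _] := qP.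
  have Iqu : ins ord0 j 1 x *m q \in unitmx by rewrite unitmx_mul Iu qu.
  have [qj1|qj1] := eqVneq (q j1 j) 0; last exact: closure_GL_sub (double_coset_parab _ _ _ _).
  (* Adding [harm k] times row [j] to row [j1] makes the entry [(j1, j)] nonzero. *)
  apply: (@closure_elem_limit _ _ _ j1 j) => // k.
  have qkP := grpM (@parab_trans j) (parab_elem jj1 (harm k)) qP.
  have [qku _] := qkP.
  apply: closure_GL_sub; first by rewrite unitmx_mul Iu.
  apply: double_coset_parab => //; rewrite elem_mulE.
    by rewrite [j == j1]eq_sym (negPf j1j) addr0.
  by rewrite eqxx qj1 add0r mulf_neq0 ?harm_neq0.
move=> pP; have [pu _] := pP.
have [pjj|/(H _ pP)//] := eqVneq (p j j) 0.
have pj1 : p j1 j != 0.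
  apply/eqP => p0; have /(grp_diag j leqnn anti_leq leq_trans) := parab_leq jj1 pP p0.
  by rewrite pjj eqxx.
(* Adding [harm k] times row [j1] to row [j] makes the pivot nonzero, so [H] applies. *)
apply: (@closure_elem_limit _ _ _ j j1) => [|k]; first by rewrite unitmx_mul Iu pu.
apply: H; last by rewrite elem_mulE eqxx pjj add0r mulf_neq0 ?harm_neq0.
apply: (grpM (@parab_trans j)) pP; apply: elem_grp; first exact: parab_refl.
  by rewrite eq_sym.
by rewrite /parab jj1 leqnSn.
Qed.

Lemma orbit_closure_ins_parabolic (x z : 'M[C]_n) p :
  x \in unitmx -> grp (parab j) p -> orbit_closure r x z ->
  orbit_closure r (ins ord0 j 1 x *m elem j1 j 1) (ins ord0 j 1 z *m p).
Proof.
move=> xu pP [zu [M [Mx Mz]]]; have [pu _] := pP; apply: closure_GL_idem; split.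
  by rewrite /invertible unitmx_mul pu andbT; apply: ins_unit; rewrite ?oner_neq0.
exists (fun k => ins ord0 j 1 (M k) *m p); split; last first.
  by apply: mx_cvgM (mx_cvg_cst _); exact: mx_cvg_ins.
move=> k; have [t [b [tr bB ->]]] := Mx k.
have -> : ins ord0 j 1 (t *m x *m b) *m p =
    ins ord0 ord0 1 t *m (ins ord0 j 1 x *m (ins j j 1 b *m p)).
  by rewrite !mulmxA !ins_mul !mulr1.
apply: orbit_closure_mull; first by apply: grp_ins00; rewrite ?oner_neq0.
apply: orbit_closure_ins_parab_self => //; apply: (grpM (@parab_trans j)) pP.
apply: (grp_sub (@leq_parab j)); apply: grp_insdiag => //; exact: oner_neq0.
Qed.

Lemma double_coset_sub_parab (x : 'M[C]_n) g :
  double_coset r leq (ins ord0 j 1 x *m elem j1 j 1) g ->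
  double_coset r (parab j) (ins ord0 j 1 x) g.
Proof.
move=> [t [b [tr bB ->]]]; exists t, (elem j1 j 1 *m b); split=> //; last by rewrite !mulmxA.
exact: grpM (@parab_trans j) (parab_elem jj1 1) (grp_sub (@leq_parab j) bB).
Qed.

End Parabolic.
End Orbits.

(** * The recursion for [X(Om)] and for torus orbit closures *)

Lemma geqnn : reflexive geq.
Proof. exact: leqnn. Qed.

Lemma geq_trans : transitive geq.
Proof. by move=> a b c ba ac; exact: leq_trans ac ba. Qed.

Section TwoOrbits.
Variables r1 r2 : rel nat.
Hypotheses (r1R : reflexive r1) (r1T : transitive r1) (r1S : forall k l, r1 k.+1 l.+1 = r1 k l).
Hypotheses (r2R : reflexive r2) (r2T : transitive r2) (r2S : forall k l, r2 k.+1 l.+1 = r2 k l).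
Hypotheses (r10 : forall k, r1 k.+1 0 = false) (r20 : forall k, r2 0 k.+1 = false).
Variables (n : nat) (j : 'I_n.+1) (x y : 'M[C]_n).
Hypotheses (xu : x \in unitmx) (yu : y \in unitmx).

(** Two uses: [leq] with [geq] gives Richardson varieties, [eqrel] twice gives torus orbit closures.
    The first closure bounds where e_1 enters the flag, the second how long the flag stays in H;
    together they factor [g], and deletion places the same [z] in both smaller closures. *)
Lemma two_orbit_closures_ins g :
  orbit_closure r1 (ins ord0 j 1 x) g /\ orbit_closure r2 (ins ord0 j 1 y) g <->
  exists z b, [/\ orbit_closure r1 x z /\ orbit_closure r2 y z, grp leq b &
    g = ins ord0 j 1 z *m b].
Proof.
split=> [[xg yg]|[z [b [[xz yz] bB ->]]]]; last by split; exact: orbit_closure_ins.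
have [gu _] := xg.
have [//|b bj|a ja|z [b [zu bB gE]]] := @ins_leq_factor _ _ j g.
- by apply: (closure_row0 r20 yg); rewrite -ltnNge.
- by apply: (closure_inv_col0 r1R r1T leqnn leq_trans r10 xu xg); rewrite -ltnNge.
have [bu _] := bB; have bV := grpV leqnn leq_trans bB.
have zE : ins ord0 j 1 z = g *m invmx b by rewrite gE mulmxK.
exists z, b; split=> //; split.
  apply: (closure_del_col0 (j := j) r1S r10 zu); rewrite zE.
  apply: closure_GL_mono (orbit_closure_mulr r1R r1T bV xg) => h [t [q [tr qB ->]]].
  by exists t, q; split=> //; exact: grp_sub (@leq_parab j) qB.
apply: (closure_del_row0 (j := j) r2R r2T r2S r20 yu zu); rewrite zE.
apply: closure_GL_mono (orbit_closure_mulr r2R r2T bV yg) => h [t [q [tr qB ->]]].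
by exists t, q; split=> //; exact: grp_sub (@leq_parab j) qB.
Qed.

(** Enlarging B to P_j absorbs the elementary factor and leaves exactly the bounds that
    [ins_parab_factor] requires. *)
Lemma two_orbit_closures_parab (j1 : 'I_n.+1) g : j1 = j.+1 :> nat ->
  orbit_closure r1 (ins ord0 j 1 x *m elem j1 j 1) g /\
  orbit_closure r2 (ins ord0 j 1 y *m elem j1 j 1) g <->
  exists z p, [/\ orbit_closure r1 x z /\ orbit_closure r2 y z, grp (parab j) p &
    g = ins ord0 j 1 z *m p].
Proof.
move=> jj1; split=> [[xg yg]|[z [p [[xz yz] pP ->]]]]; last first.
  by split; exact: orbit_closure_ins_parabolic.
have [gu _] := xg.
have {}xg := closure_GL_mono (double_coset_sub_parab jj1 (x := x)) xg.
have {}yg := closure_GL_mono (double_coset_sub_parab jj1 (x := y)) yg.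
have [//|//|b bj|a ja|z [p [zu pP gE]]] := @ins_parab_factor _ _ j j1 g.
- apply: (closure_row0 r20 yg); rewrite /parab negb_or -ltnNge bj /=.
  by rewrite (ltn_eqF bj) andbF.
- apply: (closure_inv_col0 r1R r1T (@parab_refl j) (@parab_trans j) r10 xu xg).
  by rewrite /parab -jj1 negb_or -ltnNge (gtn_eqF ja) andbT; lia.
have [pu _] := pP; have pV := grpV (@parab_refl j) (@parab_trans j) pP.
have zE : ins ord0 j 1 z = g *m invmx p by rewrite gE mulmxK.
exists z, p; split=> //; split.
  apply: (closure_del_col0 (j := j) r1S r10 zu); rewrite zE -[g]mul1mx.
  exact: (closure_double_coset_mul r1T (@parab_trans j) (grp1 _ _ r1R) pV xg).
apply: (closure_del_row0 (j := j) r2R r2T r2S r20 yu zu); rewrite zE -[g]mul1mx.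
exact: (closure_double_coset_mul r2T (@parab_trans j) (grp1 _ _ r2R) pV yg).
Qed.

End TwoOrbits.

(** * Change of base point inside an orbit *)

Lemma elem_conj_grp (r : rel nat) n (x : 'M[C]_n) (a b : 'I_n) c :
  reflexive r -> x \in unitmx -> a != b ->
  (forall k l : 'I_n, ~~ r k l -> x k a * invmx x b l = 0) -> grp r (x *m elem a b c *m invmx x).
Proof.
move=> rR xu ab H; split; first by rewrite !unitmx_mul xu elem_unit ?unitmx_inv.
rewrite mulmxDr mulmxDl mulmx1 mulmxV //; apply: shapeD; first exact: shape_scalar.
rewrite -scalemxAr -scalemxAl; apply: shapeZ => k l rkl.
(* Factoring the matrix unit through size one exhibits its conjugate as column [a] of [x] times row
   [b] of [invmx x]. *)
rewrite -(mul_delta_mx (0 : 'I_1)) mulmxA -colE -mulmxA -rowE mxE big_ord1.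
by rewrite [col _ _ _ _]mxE [row _ _ _ _]mxE H.
Qed.

Section CellShift.
Variables (n : nat) (j j1 : 'I_n.+1).
Hypothesis jj1 : j1 = j.+1 :> nat.

Let j1j : j1 != j.
Proof. by rewrite -val_eqE /= jj1 gtn_eqF. Qed.

(** Column [j1] of [ins ord0 j1 1 x] is e_1, so the conjugated elementary matrix differs from the
    identity only in the first row and lies in B. *)
Lemma orbit_closure_leq_shift (x : 'M[C]_n) g : x \in unitmx ->
  orbit_closure leq (ins ord0 j 1 x *m elem j1 j 1) g <-> orbit_closure leq (ins ord0 j1 1 x) g.
Proof.
move=> xu; have Iu : ins ord0 j1 1 x \in unitmx by apply: ins_unit; rewrite ?oner_neq0.
(* On the block this reads [0 1; 1 0] [1 0; 1 1] = [1 0; 1 1] [1 1; 0 -1]. *)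
have [b bB tE] : exists2 b, grp leq b &
    tperm_mx j j1 *m elem j1 j 1 = elem j1 j 1 *m b :> 'M[C]_n.+1.
  have sP := grpM (@parab_trans j) (parab_tperm C jj1) (parab_elem jj1 1).
  have e1 : (tperm_mx j j1 *m elem j1 j 1 : 'M[C]_n.+1) j j = 1.
    by rewrite tperm_mulE tpermL !mxE (negPf j1j) !eqxx mulr1 add0r.
  have e2 : (tperm_mx j j1 *m elem j1 j 1 : 'M[C]_n.+1) j1 j = 1.
    by rewrite tperm_mulE tpermR !mxE eqxx [j == j1]eq_sym (negPf j1j) mulr0 addr0.
  have := parab_factor jj1 sP; rewrite e1 e2 divr1; apply.
  exact: oner_neq0.
have -> : ins ord0 j 1 x *m elem j1 j 1 =
    (ins ord0 j1 1 x *m elem j1 j 1 *m invmx (ins ord0 j1 1 x)) *m ins ord0 j1 1 x *m b.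
  rewrite mulmxKV // -mulmxA -tE mulmxA -(ins_tperm jj1).
  by rewrite -(mulmxA (ins ord0 j 1 x)) tperm_mxK mulmx1.
apply: (orbit_closure_eqmx leqnn leq_trans _ _ _ bB).
apply: elem_conj_grp => // k l.
case: (unliftP ord0 k) => [k'|] -> //; by rewrite insE mul0r.
Qed.

(** Row [j] of the inverse of [ins ord0 j 1 x] is supported in the first column, so the conjugated
    elementary matrix lies in B^-. Thus T_j inserts at [j] in u but at [j1] in v. *)
Lemma orbit_closure_geq_shift (x : 'M[C]_n) g : x \in unitmx ->
  orbit_closure geq (ins ord0 j 1 x *m elem j1 j 1) g <-> orbit_closure geq (ins ord0 j 1 x) g.
Proof.
move=> xu; have Iu : ins ord0 j 1 x \in unitmx by apply: ins_unit; rewrite ?oner_neq0.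
have -> : ins ord0 j 1 x *m elem j1 j 1 =
    (ins ord0 j 1 x *m elem j1 j 1 *m invmx (ins ord0 j 1 x)) *m ins ord0 j 1 x *m 1%:M.
  by rewrite mulmxKV // mulmx1.
apply: (orbit_closure_eqmx geqnn geq_trans _ _ _ (grp1 _ _ leqnn)).
apply: elem_conj_grp => // [k|k l]; first exact: leqnn.
by case: (unliftP ord0 l) => [l'|] -> //; rewrite ins_inv // insE mulr0.
Qed.

End CellShift.

(** * Schubert varieties and torus orbits in terms of preorders *)

Lemma in_B_grp n (b : 'M[C]_n) : in_B b <-> grp leq b.
Proof. by split=> -[bu sb]; split=> // k l kl; apply: sb; rewrite ltnNge in kl *. Qed.

Lemma in_Bminus_grp n (b : 'M[C]_n) : in_Bminus b <-> grp geq b.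
Proof.
by split=> -[bu sb]; split=> // k l kl; apply: sb;
  rewrite /geq /= -?ltnNge // in kl *; rewrite ltnNge.
Qed.

Lemma in_torus_grp n (b : 'M[C]_n) : in_torus b <-> grp (fun k l => k == l) b.
Proof. by split=> -[bu sb]; split=> // k l kl; apply: sb. Qed.

Lemma schubertE n w g : schubert n w g <-> orbit_closure leq (perm_matrix n w) g.
Proof.
split; apply: closure_GL_mono => h.
  by move=> [t [b [/in_B_grp tB [/in_B_grp bB ->]]]]; exists t, b.
by move=> [t [b [/in_B_grp tB /in_B_grp bB ->]]]; exists t, b.
Qed.

Lemma opp_schubertE n w g : opp_schubert n w g <-> orbit_closure geq (perm_matrix n w) g.
Proof.
split; apply: closure_GL_mono => h.
  by move=> [t [b [/in_Bminus_grp tB [/in_B_grp bB ->]]]]; exists t, b.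
by move=> [t [b [/in_Bminus_grp tB /in_B_grp bB ->]]]; exists t, b.
Qed.

Definition eqrel : rel nat := fun k l => k == l.

Lemma torus_orbit_closureE n (x g : 'M[C]_n) :
  closure_GL (fun h => exists t b, in_torus t /\ in_B b /\ h = t *m x *m b) g <->
  orbit_closure eqrel x g.
Proof.
split; apply: closure_GL_mono => h.
  by move=> [t [b [/in_torus_grp tB [/in_B_grp bB ->]]]]; exists t, b.
by move=> [t [b [/in_torus_grp tB /in_B_grp bB ->]]]; exists t, b.
Qed.

(** Letters and [eps] count from 1, ordinals from 0, hence [j.+1]. Positivity of [w] keeps the
    shifted values away from 1. *)
Lemma perm_matrix_eps n (j : 'I_n.+1) w : (forall b, (0 < w b.+1)%N) ->
  perm_matrix n.+1 (eps j.+1 w) = ins ord0 j 1 (perm_matrix n w).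
Proof.
move=> w0; have epsL (l : 'I_n) : eps j.+1 w (lift j l).+1 = (w l.+1).+1.
  rewrite /eps /= /bump; have [jl|lj] := leqP j l.
    by rewrite add1n ifF ?ifF //; lia.
  by rewrite add0n ltnS lj.
have epsj : eps j.+1 w j.+1 = 1%N by rewrite /eps ltnn eqxx.
apply: ins_eq => *; rewrite mxE ?epsL ?epsj //.
  by rewrite eqSS eq_sym eqn0Ngt w0.
by rewrite !lift0 eqSS mxE.
Qed.

(** * Induction on the last letter of a word *)

Lemma uv_rcons Om x : uv (rcons Om x) = uv_step (uv Om) x.
Proof. by rewrite /uv foldl_rcons. Qed.

Lemma eps_gt0 j w b : (0 < eps j w b)%N.
Proof. by rewrite /eps; case: ifP => // _; case: ifP. Qed.

Lemma uv_gt0 Om b : (0 < (uv Om).1 b.+1)%N /\ (0 < (uv Om).2 b.+1)%N.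
Proof. by elim/last_ind: Om => [|Om [i|i] _] //; rewrite uv_rcons; split; exact: eps_gt0. Qed.

Lemma RTSeq_rcons n Om x :
  RTSeq n.+1 (rcons Om x) <-> RTSeq n Om /\ letter_ok n.+1 x.
Proof.
split=> [[]|[[sz ok] okx]].
  rewrite size_rcons => -[sz] ok; split; last by
    have := ok n (ltnSn n); rewrite nth_rcons sz ltnn eqxx.
  by split=> // k kn; have := ok k (ltnW kn); rewrite nth_rcons sz kn.
split; first by rewrite size_rcons sz.
move=> k; rewrite ltnS leq_eqVlt nth_rcons sz => /orP[/eqP->|kn]; first by rewrite ltnn eqxx.
by rewrite kn; exact: ok.
Qed.

Lemma replace_T_rcons Om x Om' x' :
  replace_T (rcons Om x) (rcons Om' x') <->
  replace_T Om Om' /\ (x' = x \/ exists i, x = LT i /\ (x' = LR i \/ x' = LR i.+1)).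
Proof.
split=> [[]|[[sz rep] xx']].
  rewrite !size_rcons => -[sz] rep; split; last first.
    by have := rep (size Om) (ltnSn _); rewrite !nth_rcons sz ltnn eqxx.
  by split=> // k kn; have := rep k (ltnW kn); rewrite !nth_rcons sz kn.
split; first by rewrite !size_rcons sz.
move=> k; rewrite size_rcons ltnS leq_eqVlt !nth_rcons sz => /orP[/eqP->|kn].
  by rewrite ltnn eqxx.
by rewrite kn; exact: rep.
Qed.

Lemma letter_okR n i : letter_ok n.+1 (LR i) -> exists j : 'I_n.+1, i = j.+1.
Proof. by case: i => [|i] //= ilt; exists (Ordinal ilt). Qed.

Lemma letter_okT n i : letter_ok n.+1 (LT i) ->
  exists j j1 : 'I_n.+1, i = j.+1 /\ j1 = j.+1 :> nat.
Proof. by case: i => [|i] //= ilt; exists (Ordinal (ltnW ilt)), (Ordinal ilt). Qed.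

Lemma X_of_orbit_closures n Om g : X_of n Om g <->
  orbit_closure leq (perm_matrix n (uv Om).2) g /\ orbit_closure geq (perm_matrix n (uv Om).1) g.
Proof. by rewrite -schubertE -opp_schubertE. Qed.

Lemma perm_matrix_uv_unit n Om : RTSeq n Om ->
  perm_matrix n (uv Om).1 \in unitmx /\ perm_matrix n (uv Om).2 \in unitmx.
Proof.
elim/last_ind: Om n => [|Om x IH] [|n]; try by case=> //; rewrite ?size_rcons.
  by move=> _; rewrite !unitmxE !det_mx00 unitr1.
have Iu (j : 'I_n.+1) z : z \in unitmx -> ins ord0 j (1 : C) z \in unitmx.
  by apply: ins_unit; exact: oner_neq0.
move=> /RTSeq_rcons[/IH[u1 u2] okx]; rewrite uv_rcons.
have gt1 b := (uv_gt0 Om b).1; have gt2 b := (uv_gt0 Om b).2.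
case: x okx => i.
  by move=> /letter_okR[j ->]; rewrite /= !perm_matrix_eps //; split; exact: Iu.
move=> /letter_okT[j [j1 [-> jj1]]] /=; rewrite -jj1.
by rewrite !perm_matrix_eps // jj1 perm_matrix_eps //; split; exact: Iu.
Qed.

Section Recursion.
Variables (n : nat) (Om : seq letter).
Hypothesis Om_ok : RTSeq n Om.

Lemma X_of_R (j : 'I_n.+1) g : X_of n.+1 (rcons Om (LR j.+1)) g <->
  exists z b, [/\ X_of n Om z, grp leq b & g = ins ord0 j 1 z *m b].
Proof.
have [u1 u2] := perm_matrix_uv_unit Om_ok.
have gt1 b := (uv_gt0 Om b).1; have gt2 b := (uv_gt0 Om b).2.
rewrite X_of_orbit_closures uv_rcons /= !perm_matrix_eps //.
rewrite (two_orbit_closures_ins leqnn leq_trans _ geqnn geq_trans) //.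
by split=> -[z [b [/X_of_orbit_closures Xz bB gE]]]; exists z, b.
Qed.

Lemma X_of_T (j j1 : 'I_n.+1) g : j1 = j.+1 :> nat ->
  X_of n.+1 (rcons Om (LT j.+1)) g <->
  exists z p, [/\ X_of n Om z, grp (parab j) p & g = ins ord0 j 1 z *m p].
Proof.
move=> jj1; have [u1 u2] := perm_matrix_uv_unit Om_ok.
have gt1 b := (uv_gt0 Om b).1; have gt2 b := (uv_gt0 Om b).2.
rewrite X_of_orbit_closures uv_rcons /= -{1}jj1 !perm_matrix_eps //.
(* The insertions at [j1] for v and at [j] for u are brought to the common form
   [ins ord0 j 1 _ *m elem j1 j 1]. *)
rewrite -(orbit_closure_leq_shift jj1) // -(orbit_closure_geq_shift jj1) //.
rewrite (two_orbit_closures_parab leqnn leq_trans _ geqnn geq_trans) //.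
by split=> -[z [b [/X_of_orbit_closures Xz bB gE]]]; exists z, b.
Qed.

End Recursion.

(** * Torus orbit closures under insertion *)

Lemma eqrel_trans : transitive eqrel.
Proof. by move=> a b c /eqP-> . Qed.

Lemma orbit_closure_eqrel_ins n (j : 'I_n.+1) (x : 'M[C]_n) g : x \in unitmx ->
  orbit_closure eqrel (ins ord0 j 1 x) g <->
  exists z b, [/\ orbit_closure eqrel x z, grp leq b & g = ins ord0 j 1 z *m b].
Proof.
move=> xu; have := two_orbit_closures_ins (@eqxx _) eqrel_trans (fun _ _ => erefl)
  (@eqxx _) eqrel_trans (fun _ _ => erefl) (fun=> erefl) (fun=> erefl) j xu xu g.
move=> [H1 H2]; split.
  by move=> xg; have [//|z [b [[xz _] bB gE]]] := H1; exists z, b.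
by move=> [z [b [xz bB gE]]]; have [|//] := H2; exists z, b.
Qed.

Lemma orbit_closure_eqrel_parab n (j j1 : 'I_n.+1) (x : 'M[C]_n) g :
  j1 = j.+1 :> nat -> x \in unitmx ->
  orbit_closure eqrel (ins ord0 j 1 x *m elem j1 j 1) g <->
  exists z p, [/\ orbit_closure eqrel x z, grp (parab j) p & g = ins ord0 j 1 z *m p].
Proof.
move=> jj1 xu; have := two_orbit_closures_parab (@eqxx _) eqrel_trans (fun _ _ => erefl)
  (@eqxx _) eqrel_trans (fun _ _ => erefl) (fun=> erefl) (fun=> erefl) xu xu g jj1.
move=> [H1 H2]; split.
  by move=> xg; have [//|z [b [[xz _] bB gE]]] := H1; exists z, b.
by move=> [z [b [xz bB gE]]]; have [|//] := H2; exists z, b.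
Qed.

Lemma orbit_closure_eqrel_mulr n (x b : 'M[C]_n) g :
  grp leq b -> orbit_closure eqrel (x *m b) g <-> orbit_closure eqrel x g.
Proof.
move=> bB; rewrite -{1}[x]mul1mx; apply: (orbit_closure_eqmx _ eqrel_trans _ _ _ bB).
  exact: eqxx.
by apply: grp1; exact: eqxx.
Qed.

Lemma orbit_closure_eqrel_generic n (j j1 : 'I_n.+1) (x : 'M[C]_n) p g :
  j1 = j.+1 :> nat -> grp (parab j) p -> p j j != 0 -> p j1 j != 0 ->
  orbit_closure eqrel (ins ord0 j 1 x *m p) g <->
  orbit_closure eqrel (ins ord0 j 1 x *m elem j1 j 1) g.
Proof.
move=> jj1 pP pjj pj1.
have [t [b [tE bB ->]]] :=
  double_coset_parab (@eqxx _ : reflexive eqrel) (fun _ _ => erefl) jj1 x pP pjj pj1.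
by apply: (orbit_closure_eqmx _ eqrel_trans) => //; exact: eqxx.
Qed.

(** * From words to torus orbit closures and back *)

Lemma X_of_unit n Om g : X_of n Om g -> g \in unitmx.
Proof. by case=> -[]. Qed.

Lemma mx0_eq (A B : 'M[C]_0) : A = B.
Proof. by apply/matrixP => -[]. Qed.

Lemma mx0_orbit_closure r (x g : 'M[C]_0) : reflexive r -> orbit_closure r x g.
Proof. by move=> rR; rewrite (mx0_eq g x); apply: orbit_closure_self => //;
  rewrite unitmxE det_mx00 unitr1. Qed.

Lemma X_of_nil g : X_of 0 [::] g.
Proof.
by rewrite X_of_orbit_closures; split; apply: mx0_orbit_closure; [exact: leqnn|exact: geqnn].
Qed.

(** The base point is built along the word, by [ins] for R_j and by [ins] times the elementary
    matrix for T_j; both sides then obey the same recursion. *)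
Lemma X_of_orbit_closure n Om : RTSeq n Om ->
  exists2 x, x \in unitmx & forall g, X_of n Om g <-> orbit_closure eqrel x g.
Proof.
elim/last_ind: Om n => [|Om a IH] [|n]; try by case=> //; rewrite ?size_rcons.
  move=> _; exists 1%:M => [|g]; first exact: unitmx1.
  by split=> _; [apply: mx0_orbit_closure; exact: eqxx|exact: X_of_nil].
move=> /RTSeq_rcons[ok oka]; have [x xu Xx] := IH n ok.
have Iu j : ins ord0 j 1 x \in unitmx by apply: ins_unit; rewrite ?oner_neq0.
case: a oka => i.
  move=> /letter_okR[j ->]; exists (ins ord0 j 1 x) => // g.
  rewrite X_of_R // orbit_closure_eqrel_ins //.
  by split=> -[z [b [/Xx Xz bB gE]]]; exists z, b.
move=> /letter_okT[j [j1 [-> jj1]]]; exists (ins ord0 j 1 x *m elem j1 j 1).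
  by rewrite unitmx_mul Iu elem_unit // -val_eqE /= jj1 gtn_eqF.
move=> g; rewrite (X_of_T ok _ jj1) orbit_closure_eqrel_parab //.
by split=> -[z [b [/Xx Xz bB gE]]]; exists z, b.
Qed.

Lemma replace_T_ok n Om Om' : RTSeq n Om -> replace_T Om Om' -> RTSeq n Om'.
Proof.
move=> [sz ok] [sz' rep]; split; first by rewrite sz'.
move=> k kn; have := ok k kn; have [|->//|[i [-> [->|->]]]] := rep k; first by rewrite sz.
  by case/andP=> /= -> /ltnW.
by case/andP=> /= _ ->.
Qed.

Lemma ins_next_factor n (j j1 : 'I_n.+1) (z : 'M[C]_n) b : j1 = j.+1 :> nat -> grp leq b ->
  exists2 p, grp (parab j) p & ins ord0 j1 1 z *m b = ins ord0 j 1 z *m p.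
Proof.
move=> jj1 bB; exists (tperm_mx j j1 *m b); last by rewrite mulmxA ins_tperm.
exact: (grpM (@parab_trans j) (parab_tperm _ jj1) (grp_sub (@leq_parab j) bB)).
Qed.

(** Compared with T_j, the letter R_j restricts the P_j factor to B, and R_(j+1) restricts it to the
    coset of B by the simple transposition. *)
Lemma X_of_replace n Om Om' g : RTSeq n Om -> replace_T Om Om' -> X_of n Om' g -> X_of n Om g.
Proof.
elim/last_ind: Om n Om' g => [|Om a IH] [|n] Om' g; try by case=> //; rewrite ?size_rcons.
  by move=> _ _ _; exact: X_of_nil.
move=> ok_ rep; have ok'_ := replace_T_ok ok_ rep.
case/lastP: Om' rep ok'_ => [|Om' a']; first by case; rewrite size_rcons.
move=> /replace_T_rcons[rep aa'] /RTSeq_rcons[ok' oka'].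
move: ok_ => /RTSeq_rcons[ok oka].
have H z : X_of n Om' z -> X_of n Om z by exact: IH.
have case_eq : X_of n.+1 (rcons Om' a) g -> X_of n.+1 (rcons Om a) g.
  case: a {aa' oka'} oka => i.
    move=> /letter_okR[j ->]; rewrite !X_of_R //.
    by move=> [z [b [/H Xz bB gE]]]; exists z, b.
  move=> /letter_okT[j [j1 [-> jj1]]]; rewrite !(X_of_T _ _ jj1) //.
  by move=> [z [b [/H Xz bB gE]]]; exists z, b.
case: aa' => [->//|[i [aE a'E]]]; subst a.
have [j [j1 [iE jj1]]] := letter_okT oka; subst i.
rewrite (X_of_T ok _ jj1); case: a'E => ->.
  rewrite X_of_R // => -[z [b [/H Xz bB ->]]]; exists z, b; split=> //.
  exact: grp_sub (@leq_parab j) bB.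
rewrite -jj1 X_of_R // => -[z [b [/H Xz bB ->]]].
by have [p pP ->] := ins_next_factor z jj1 bB; exists z, p.
Qed.

(** Induction gives the word for [z]. The last letter records the torus orbit of the class of [p] in
    P_j/B: one of the two fixed points, or the open orbit. *)
Lemma orbit_closure_in_X_of n Om x : RTSeq n Om -> X_of n Om x ->
  exists2 Om', replace_T Om Om' & forall g, orbit_closure eqrel x g <-> X_of n Om' g.
Proof.
elim/last_ind: Om n x => [|Om a IH] [|n] x; try by case=> //; rewrite ?size_rcons.
  move=> _ _; exists [::] => // g.
  by split=> _; [exact: X_of_nil|apply: mx0_orbit_closure; exact: eqxx].
move=> /RTSeq_rcons[ok oka].
have caseR (Om' : seq letter) (j : 'I_n.+1) z b : RTSeq n Om' -> z \in unitmx -> grp leq b ->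
    (forall g, orbit_closure eqrel z g <-> X_of n Om' g) ->
    forall g, orbit_closure eqrel (ins ord0 j 1 z *m b) g <-> X_of n.+1 (rcons Om' (LR j.+1)) g.
  move=> ok' zu bB zX g; rewrite orbit_closure_eqrel_mulr // orbit_closure_eqrel_ins // X_of_R //.
  by split=> -[z' [b' [/zX Xz bB' gE]]]; exists z', b'.
case: a oka => i.
  move=> /letter_okR[j ->]; rewrite X_of_R // => -[z [b [Xz bB ->]]].
  have [Om' rep zX] := IH _ _ ok Xz; exists (rcons Om' (LR j.+1)).
    by apply/replace_T_rcons; split=> //; left.
  by apply: caseR zX => //; [exact: replace_T_ok rep|exact: X_of_unit Xz].
move=> /letter_okT[j [j1 [-> jj1]]]; rewrite (X_of_T ok _ jj1) => -[z [p [Xz pP ->]]].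
have [Om' rep zX] := IH _ _ ok Xz; have ok' := replace_T_ok ok rep.
have zu := X_of_unit Xz.
have [pj1|pj1] := eqVneq (p j1 j) 0.
  exists (rcons Om' (LR j.+1)); last by apply: caseR zX => //; exact: parab_leq pP pj1.
  by apply/replace_T_rcons; split=> //; right; exists j.+1; split=> //; left.
have [pj|pj] := eqVneq (p j j) 0.
  exists (rcons Om' (LR j1.+1)).
    by apply/replace_T_rcons; split=> //; right; exists j.+1; split=> //; right; rewrite jj1.
  (* The square of the transposition is inserted: one copy moves the insertion to [j1], the other
     makes [p] upper triangular. *)
  rewrite -[p]mul1mx -(tperm_mxK C j j1) -mulmxA mulmxA ins_tperm //.
  by apply: caseR zX => //; exact: parab_tperm_factor.
exists (rcons Om' (LT j.+1)); first by apply/replace_T_rcons; split=> //; left.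
move=> g; rewrite (orbit_closure_eqrel_generic _ _ jj1 pP pj pj1).
rewrite (orbit_closure_eqrel_parab _ jj1) // (X_of_T ok' _ jj1).
by split=> -[z' [b' [/zX Xz' bB' gE]]]; exists z', b'.
Qed.

Theorem mainTheorem12 (n : nat) (Om : seq letter) :
  RTSeq n Om ->
  forall Y : 'M[C]_n -> Prop,
    (torus_orbit_closure Y /\ (forall g, Y g -> X_of n Om g)) <->
    (exists Om' : seq letter, replace_T Om Om' /\ (forall g, Y g <-> X_of n Om' g)).
Proof.
move=> ok Y; split=> [[[x [xu Yx]] YX]|[Om' [rep YX]]].
  have Yorb g : Y g <-> orbit_closure eqrel x g by rewrite Yx torus_orbit_closureE.
  have Xx : X_of n Om x by apply/YX/Yorb/orbit_closure_self => //; exact: eqxx.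
  by have [Om' rep xX] := orbit_closure_in_X_of ok Xx; exists Om'; split=> // g; rewrite Yorb xX.
have [x xu Xx] := X_of_orbit_closure (replace_T_ok ok rep); split.
  by exists x; split=> // g; rewrite YX Xx torus_orbit_closureE.
by move=> g /YX; exact: X_of_replace.
Qed.
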